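(* For all processes $p,q$ of $\mathrm{CLL}_R$ and every context $C_X$ (a term whose free variables are among $\{X\}$): if $p\sqsubseteq_{RS}q$ then $C_X\{p/X\}\sqsubseteq_{RS}C_X\{q/X\}$.
   Context: Fix a set $Act$ of visible actions and let $Act_\tau=Act\cup\{\tau\}$; $a$ ranges over $Act$, $\alpha$ over $Act_\tau$. Terms of $\mathrm{CLL}_R$: $t::=0\mid\bot\mid\alpha.t\mid t\Box t\mid t\wedge t\mid t\vee t\mid t\parallel_A t\mid X\mid\langle X|E\rangle$, where $X$ is a variable, $A\subseteq Act$, and $E$ is a recursive specification, i.e. a finite nonempty set of equations $\{Y=t_Y:Y\in V\}$ over a set $V$ of variables with $X\in V$ (the variables of $V$ are bound in $\langle X|E\rangle$; recursive variables of distinct specifications are distinct and never occur free). A process is a closed term. For $E$ over $V$, $\langle t|E\rangle$ is $t$ with every free occurrence of each $Y\in V$ replaced by $\langle Y|E\rangle$. An occurrence of a variable in $t$ is strongly guarded if it lies within a subterm $a.t'$ ($a\in Act$), weakly guarded if it lies within a subterm $\tau.t'$ or $t_1\vee t_2$. All recursive specifications are assumed guarded: each occurrence of each $Y\in V$ in each right-hand side of $E$ is weakly or strongly guarded. $C_X\{p/X\}$ is simultaneous substitution of $p$ for the free occurrences of $X$ (bound variables renamed if needed). The transitions $\stackrel{\alpha}{\longrightarrow}$ between processes and the inconsistency predicate $F$ (a set of processes) are given by the unique stable model of the following stratified transition system specification with negative premises ($x\not\stackrel{\alpha}{\longrightarrow}$: no $\alpha$-transition; $z\stackrel{\epsilon}{\Longrightarrow}|y$: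 $z(\stackrel{\tau}{\longrightarrow})^*y$ and $y\not\stackrel{\tau}{\longrightarrow}$). Operational rules: $\alpha.x\stackrel{\alpha}{\to}x$; if $x_1\stackrel{a}{\to}y_1$ and $x_2\not\stackrel{\tau}{\to}$ then $x_1\Box x_2\stackrel a\to y_1$ and $x_2\Box x_1\stackrel a\to y_1$; if $x_1\stackrel\tau\to y_1$ then $x_1\Box x_2\stackrel\tau\to y_1\Box x_2$, $x_2\Box x_1\stackrel\tau\to x_2\Box y_1$, $x_1\wedge x_2\stackrel\tau\to y_1\wedge x_2$, $x_2\wedge x_1\stackrel\tau\to x_2\wedge y_1$, $x_1\parallel_A x_2\stackrel\tau\to y_1\parallel_A x_2$, $x_2\parallel_A x_1\stackrel\tau\to x_2\parallel_A y_1$; if $x_1\stackrel a\to y_1$ and $x_2\stackrel a\to y_2$ then $x_1\wedge x_2\stackrel a\to y_1\wedge y_2$, and if also $a\in A$ then $x_1\parallel_A x_2\stackrel a\to y_1\parallel_A y_2$; if $a\notin A$, $x_1\stackrel a\to y_1$, $x_2\not\stackrel\tau\to$ then $x_1\parallel_A x_2\stackrel a\to y_1\parallel_A x_2$ and $x_2\parallel_A x_1\stackrel a\to x_2\parallel_A y_1$; $x_1\vee x_2\stackrel\tau\to x_1$, $x_1\vee x_2\stackrel\tau\to x_2$; if $Y=t_Y\in E$ and $\langle t_Y|E\rangle\stackrel\alpha\to y$ then $\langle Y|E\rangle\stackrel\alpha\to y$. Predicate rules: $\bot\in F$; $x\in F\Rightarrow\alpha.x\in F$; $x_1,x_2\in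 F\Rightarrow x_1\vee x_2\in F$; if $x_1\in F$ or $x_2\in F$ then $x_1\Box x_2,\ x_1\parallel_A x_2,\ x_1\wedge x_2\in F$; if $x_1\wedge x_2\not\stackrel\tau\to$ and one of $x_1,x_2$ has an $a$-transition while the other has none, then $x_1\wedge x_2\in F$; if $x_1\wedge x_2\stackrel\alpha\to z$ for some $z$ and all $y$ with $x_1\wedge x_2\stackrel\alpha\to y$ are in $F$, then $x_1\wedge x_2\in F$; if all $y$ with $x_1\wedge x_2\stackrel\epsilon\Longrightarrow|y$ are in $F$ then $x_1\wedge x_2\in F$; if $Y=t_Y\in E$ and $\langle t_Y|E\rangle\in F$ then $\langle Y|E\rangle\in F$; if all $y$ with $\langle Y|E\rangle\stackrel\epsilon\Longrightarrow|y$ are in $F$ then $\langle Y|E\rangle\in F$. Notation: $\mathcal I(p)=\{\alpha:\exists q.\,p\stackrel\alpha\to q\}$; $p$ is stable if $\tau\notin\mathcal I(p)$. $p\stackrel\epsilon\Longrightarrow_F q$: a sequence of $\tau$-transitions from $p$ to $q$ with all states (including $p,q$) outside $F$; $p\stackrel a\Longrightarrow_F q$: $p\stackrel\epsilon\Longrightarrow_F p_1\stackrel a\to p_2\stackrel\epsilon\Longrightarrow_F q$ with all states outside $F$; appending $|$ requires in addition that $q$ is stable. A relation $\mathcal R$ on processes is a stable ready simulation if for all $(p,q)\in\mathcal R$, $a\in Act$: $p,q$ are stable; $p\notin F$ implies $q\notin F$; $p\stackrel a\Longrightarrow_F|p'$ implies $q\stackrel a\Longrightarrow_F|q'$ for some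 $q'$ with $(p',q')\in\mathcal R$; $p\notin F$ implies $\mathcal I(p)=\mathcal I(q)$. $p\underset{\sim}{\sqsubset}_{RS}q$ iff some stable ready simulation contains $(p,q)$. $p\sqsubseteq_{RS}q$ iff for every $p'$ with $p\stackrel\epsilon\Longrightarrow_F|p'$ there is $q'$ with $q\stackrel\epsilon\Longrightarrow_F|q'$ and $p'\underset\sim\sqsubset_{RS}q'$. *)

(* Defs.v *)
From mathcomp Require Import all_boot.
From Stdlib Require Import Relation_Operators.

Set Implicit Arguments.
Unset Strict Implicit.
Unset Printing Implicit Defensive.

(** * Syntax *)

Definition var := nat.

Inductive label (Act : Type) : Type :=
| tau : label Act
| vis : Act -> label Act.
Arguments tau {Act}.

(** A recursive specification [{Y = t_Y : Y \in V}] is the list of its pairs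
    [(Y, t_Y)]; [wf] below requires that there is one equation per variable. *)
Inductive term (Act : Type) : Type :=
| Nil : term Act
| Bot : term Act
| Pref : label Act -> term Act -> term Act
| Ext : term Act -> term Act -> term Act
| Conj : term Act -> term Act -> term Act
| Disj : term Act -> term Act -> term Act
| Par : (Act -> Prop) -> term Act -> term Act -> term Act
| Var : var -> term Act
| Rec : var -> seq (var * term Act) -> term Act.
Arguments Nil {Act}.
Arguments Bot {Act}.
Arguments Var {Act} _.

Notation spec Act := (seq (var * term Act)).

Definition dom (Act : Type) (E : spec Act) : seq var := [seq e.1 | e <- E].

Fixpoint rhs (Act : Type) (E : spec Act) (Y : var) : option (term Act) :=
  if E is (Z, t) :: E' then if Y == Z then Some t else rhs E' Y else None.

Fixpoint free_in (Act : Type) (y : var) (t : term Act) : bool :=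
  match t with
  | Nil | Bot => false
  | Pref _ u => free_in y u
  | Ext u v | Conj u v | Disj u v | Par _ u v => free_in y u || free_in y v
  | Var x => y == x
  | Rec _ E => (y \notin dom E) && has (fun e => free_in y e.2) E
  end.

(** Some free occurrence of [y] in [t] is neither strongly nor weakly guarded:
    it lies in no subterm [a.u], [tau.u] or [u \/ v] of [t]. *)
Fixpoint unguarded_in (Act : Type) (y : var) (t : term Act) : bool :=
  match t with
  | Nil | Bot | Pref _ _ | Disj _ _ => false
  | Ext u v | Conj u v | Par _ u v => unguarded_in y u || unguarded_in y v
  | Var x => y == x
  | Rec _ E => (y \notin dom E) && has (fun e => unguarded_in y e.2) E
  end.

(** In every subterm [<X|E>], [E] has one equation per variable, [X] is one of
    its variables, and [E] is guarded. *)
Fixpoint wf (Act : Type) (t : term Act) : bool :=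
  match t with
  | Nil | Bot | Var _ => true
  | Pref _ u => wf u
  | Ext u v | Conj u v | Disj u v | Par _ u v => wf u && wf v
  | Rec x E =>
      [&& uniq (dom E), x \in dom E,
          all (fun e => all (fun y => ~~ unguarded_in y e.2) (dom E)) E
        & all (fun e => wf e.2) E]
  end.

Definition process (Act : Type) (t : term Act) : Prop :=
  wf t /\ forall y, ~~ free_in y t.

Definition context (Act : Type) (X : var) (C : term Act) : Prop :=
  wf C /\ forall y, free_in y C -> y = X.

(** Simultaneous substitution for free occurrences.  Bound variables are not
    renamed: only closed terms are ever substituted (in [subst1], a process;
    in [unfold], the [<Y|E>] of a closed [<X|E>]), so nothing is captured. *)
Definition mask (Act : Type) (V : seq var) (s : var -> option (term Act)) :=
  fun y => if y \in V then None else s y.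

Fixpoint subst (Act : Type) (s : var -> option (term Act)) (t : term Act) :
    term Act :=
  match t with
  | Nil => Nil
  | Bot => Bot
  | Pref l u => Pref l (subst s u)
  | Ext u v => Ext (subst s u) (subst s v)
  | Conj u v => Conj (subst s u) (subst s v)
  | Disj u v => Disj (subst s u) (subst s v)
  | Par A u v => Par A (subst s u) (subst s v)
  | Var x => if s x is Some u then u else Var x
  | Rec x E => Rec x [seq (e.1, subst (mask (dom E) s) e.2) | e <- E]
  end.

(** [C{p/X}] *)
Definition subst1 (Act : Type) (X : var) (p C : term Act) : term Act :=
  subst (fun y => if y == X then Some p else None) C.

(** [<t|E>] *)
Definition unfold (Act : Type) (E : spec Act) (t : term Act) : term Act :=
  subst (fun y => if y \in dom E then Some (Rec y E) else None) t.

(** * Transitions and inconsistency *)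

Definition lts (Act : Type) := term Act -> label Act -> term Act -> Prop.

Definition can (Act : Type) (tr : lts Act) (p : term Act) (l : label Act) :=
  exists q, tr p l q.

Definition stable (Act : Type) (tr : lts Act) (p : term Act) : Prop :=
  ~ can tr p tau.

Definition eps_stable (Act : Type) (tr : lts Act) (p q : term Act) : Prop :=
  clos_refl_trans_1n _ (fun x y => tr x tau y) p q /\ stable tr q.

(** The reduct of the specification by a candidate model: negative occurrences
    of transitions are read off the candidate [M], and the positive part is the
    least relation closed under the rules.  The rules are written for all terms;
    [step_process] and [process_unfold] below show that from a process they only
    reach processes.  The predicate [F] has no negative occurrence. *)
Inductive step_red (Act : Type) (M : lts Act) :
    term Act -> label Act -> term Act -> Prop :=
| step_pref l x : step_red M (Pref l x) l x
| step_ext_l a x1 x2 y1 : step_red M x1 (vis a) y1 -> stable M x2 ->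
    step_red M (Ext x1 x2) (vis a) y1
| step_ext_r a x1 x2 y1 : step_red M x1 (vis a) y1 -> stable M x2 ->
    step_red M (Ext x2 x1) (vis a) y1
| step_ext_tau_l x1 x2 y1 : step_red M x1 tau y1 ->
    step_red M (Ext x1 x2) tau (Ext y1 x2)
| step_ext_tau_r x1 x2 y1 : step_red M x1 tau y1 ->
    step_red M (Ext x2 x1) tau (Ext x2 y1)
| step_conj_tau_l x1 x2 y1 : step_red M x1 tau y1 ->
    step_red M (Conj x1 x2) tau (Conj y1 x2)
| step_conj_tau_r x1 x2 y1 : step_red M x1 tau y1 ->
    step_red M (Conj x2 x1) tau (Conj x2 y1)
| step_conj_sync a x1 x2 y1 y2 :
    step_red M x1 (vis a) y1 -> step_red M x2 (vis a) y2 ->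
    step_red M (Conj x1 x2) (vis a) (Conj y1 y2)
| step_disj_l x1 x2 : step_red M (Disj x1 x2) tau x1
| step_disj_r x1 x2 : step_red M (Disj x1 x2) tau x2
| step_par_tau_l A x1 x2 y1 : step_red M x1 tau y1 ->
    step_red M (Par A x1 x2) tau (Par A y1 x2)
| step_par_tau_r A x1 x2 y1 : step_red M x1 tau y1 ->
    step_red M (Par A x2 x1) tau (Par A x2 y1)
| step_par_l (A : Act -> Prop) a x1 x2 y1 : ~ A a ->
    step_red M x1 (vis a) y1 -> stable M x2 ->
    step_red M (Par A x1 x2) (vis a) (Par A y1 x2)
| step_par_r (A : Act -> Prop) a x1 x2 y1 : ~ A a ->
    step_red M x1 (vis a) y1 -> stable M x2 ->
    step_red M (Par A x2 x1) (vis a) (Par A x2 y1)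
| step_par_sync (A : Act -> Prop) a x1 x2 y1 y2 : A a ->
    step_red M x1 (vis a) y1 -> step_red M x2 (vis a) y2 ->
    step_red M (Par A x1 x2) (vis a) (Par A y1 y2)
| step_rec l Y E t y : rhs E Y = Some t -> step_red M (unfold E t) l y ->
    step_red M (Rec Y E) l y.

Inductive F_red (Act : Type) (M : lts Act) : term Act -> Prop :=
| F_bot : F_red M Bot
| F_pref l x : F_red M x -> F_red M (Pref l x)
| F_disj x1 x2 : F_red M x1 -> F_red M x2 -> F_red M (Disj x1 x2)
| F_ext_l x1 x2 : F_red M x1 -> F_red M (Ext x1 x2)
| F_ext_r x1 x2 : F_red M x2 -> F_red M (Ext x1 x2)
| F_par_l A x1 x2 : F_red M x1 -> F_red M (Par A x1 x2)
| F_par_r A x1 x2 : F_red M x2 -> F_red M (Par A x1 x2)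
| F_conj_l x1 x2 : F_red M x1 -> F_red M (Conj x1 x2)
| F_conj_r x1 x2 : F_red M x2 -> F_red M (Conj x1 x2)
| F_conj_mismatch_l a x1 x2 : stable M (Conj x1 x2) ->
    can (step_red M) x1 (vis a) -> ~ can M x2 (vis a) -> F_red M (Conj x1 x2)
| F_conj_mismatch_r a x1 x2 : stable M (Conj x1 x2) ->
    can (step_red M) x2 (vis a) -> ~ can M x1 (vis a) -> F_red M (Conj x1 x2)
| F_conj_step l x1 x2 : can (step_red M) (Conj x1 x2) l ->
    (forall y, M (Conj x1 x2) l y -> F_red M y) -> F_red M (Conj x1 x2)
| F_conj_eps x1 x2 :
    (forall y, eps_stable M (Conj x1 x2) y -> F_red M y) ->
    F_red M (Conj x1 x2)
| F_rec Y E t : rhs E Y = Some t -> F_red M (unfold E t) -> F_red M (Rec Y E)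
| F_rec_eps Y E :
    (forall y, eps_stable M (Rec Y E) y -> F_red M y) -> F_red M (Rec Y E).

(** See [stable_model_ex] and [stable_model_uniq] below. *)
Definition stable_model (Act : Type) (tr : lts Act) (F : term Act -> Prop) :
    Prop :=
  (forall p l q, tr p l q <-> step_red tr p l q) /\
  (forall p, F p <-> F_red tr p).

(** * Ready simulation *)

Definition eps_F (Act : Type) (tr : lts Act) (F : term Act -> Prop)
    (p q : term Act) : Prop :=
  ~ F p /\ clos_refl_trans_1n _ (fun x y => tr x tau y /\ ~ F y) p q.

Definition weak_F (Act : Type) (tr : lts Act) (F : term Act -> Prop)
    (p : term Act) (a : Act) (q : term Act) : Prop :=
  exists p1 p2, [/\ eps_F tr F p p1, tr p1 (vis a) p2 & eps_F tr F p2 q].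

Definition eps_F_stable (Act : Type) (tr : lts Act) (F : term Act -> Prop)
    (p q : term Act) : Prop :=
  eps_F tr F p q /\ stable tr q.

Definition weak_F_stable (Act : Type) (tr : lts Act) (F : term Act -> Prop)
    (p : term Act) (a : Act) (q : term Act) : Prop :=
  weak_F tr F p a q /\ stable tr q.

Definition stable_ready_simulation (Act : Type) (tr : lts Act)
    (F : term Act -> Prop) (R : term Act -> term Act -> Prop) : Prop :=
  (forall p q, R p q -> process p /\ process q) /\
  (forall p q, R p q ->
    [/\ stable tr p /\ stable tr q,
        ~ F p -> ~ F q,
        forall a p', weak_F_stable tr F p a p' ->
          exists q', weak_F_stable tr F q a q' /\ R p' q'
      & ~ F p -> forall l, can tr p l <-> can tr q l]).

Definition rs_stable (Act : Type) (tr : lts Act) (F : term Act -> Prop)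
    (p q : term Act) : Prop :=
  exists R, stable_ready_simulation tr F R /\ R p q.

Definition rs (Act : Type) (tr : lts Act) (F : term Act -> Prop)
    (p q : term Act) : Prop :=
  forall p', eps_F_stable tr F p p' ->
    exists q', eps_F_stable tr F q q' /\ rs_stable tr F p' q'.

(** * The stable model exists, is unique, and lives on processes *)

Lemma step_red_tau (Act : Type) (M M' : lts Act) p q :
  step_red M p tau q -> step_red M' p tau q.
Proof.
have gen l : step_red M p l q -> l = tau -> step_red M' p l q.
  by elim=> {p q l}; try (by []); intros; subst; econstructor; eauto.
by move=> /gen; apply.
Qed.

Lemma step_red_ext (Act : Type) (M M' : lts Act) :
  (forall p, stable M p -> stable M' p) ->
  forall p l q, step_red M p l q -> step_red M' p l q.
Proof. by move=> MM' p l q; elim=> *; econstructor; eauto. Qed.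

Lemma F_red_ext (Act : Type) (M M' : lts Act) :
  (forall p l q, M p l q <-> M' p l q) ->
  forall p, F_red M p -> F_red M' p.
Proof.
move=> MM'.
have can_MM' p l : can M p l <-> can M' p l.
  by split=> -[q /MM' pq]; exists q.
have st p : stable M p -> stable M' p by move=> sp /can_MM'.
have sr p l : can (step_red M) p l -> can (step_red M') p l.
  by case=> q /(step_red_ext st) pq; exists q.
have ep p q : eps_stable M' p q -> eps_stable M p q.
  case=> pq sq; split; last by move=> /can_MM'.
  elim: pq {sq} => [x|x y z /MM' xy _ yz]; first exact: rt1n_refl.
  exact: rt1n_trans xy yz.
move=> p; elim=> {p}; intros.
- exact: F_bot.
- exact: F_pref.
- exact: F_disj.
- exact: F_ext_l.
- exact: F_ext_r.
- exact: F_par_l.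
- exact: F_par_r.
- exact: F_conj_l.
- exact: F_conj_r.
- by apply: (@F_conj_mismatch_l _ _ a); auto => /can_MM'.
- by apply: (@F_conj_mismatch_r _ _ a); auto => /can_MM'.
- by apply: (@F_conj_step _ _ l); auto => y /MM'; auto.
- by apply: F_conj_eps => y /ep; auto.
- by apply: F_rec; eauto.
- by apply: F_rec_eps => y /ep; auto.
Qed.

Lemma stable_model_ex (Act : Type) :
  exists (tr : lts Act) (F : term Act -> Prop), stable_model tr F.
Proof.
pose tr := step_red (step_red (fun (_ : term Act) _ _ => False)).
exists tr, (F_red tr); split=> // p l q.
split; apply: step_red_ext => x sx -[y xy]; apply: sx; exists y;
  exact: step_red_tau xy.
Qed.

Lemma stable_model_uniq (Act : Type) (tr tr' : lts Act)
    (F F' : term Act -> Prop) :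
  stable_model tr F -> stable_model tr' F' ->
  (forall p l q, tr p l q <-> tr' p l q) /\ (forall p, F p <-> F' p).
Proof.
move=> [trE FE] [trE' FE'].
have eq_tr p l q : tr p l q <-> tr' p l q.
  split.
    move/trE=> pq; apply/trE'; apply: step_red_ext pq => x sx -[y /trE' xy].
    by apply: sx; exists y; apply/trE; apply: step_red_tau xy.
  move/trE'=> pq; apply/trE; apply: step_red_ext pq => x sx -[y /trE xy].
  by apply: sx; exists y; apply/trE'; apply: step_red_tau xy.
split=> // p; split.
  by move/FE=> Fp; apply/FE'; apply: F_red_ext Fp.
move/FE'=> Fp; apply/FE; apply: F_red_ext Fp => *.
by split=> /eq_tr.
Qed.

Lemma term_nested_ind (Act : Type) (P : term Act -> Prop) :
  P Nil -> P Bot -> (forall l u, P u -> P (Pref l u)) ->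
  (forall u v, P u -> P v -> P (Ext u v)) ->
  (forall u v, P u -> P v -> P (Conj u v)) ->
  (forall u v, P u -> P v -> P (Disj u v)) ->
  (forall A u v, P u -> P v -> P (Par A u v)) ->
  (forall x, P (Var x)) ->
  (forall x E, foldr (fun e Q => P e.2 /\ Q) True E -> P (Rec x E)) ->
  forall t, P t.
Proof.
move=> hN hB hP hE hC hD hA hV hR; fix IH 1.
case=> [||l u|u v|u v|u v|A u v|x|x E];
  [exact: hN|exact: hB|exact: hP|exact: hE|exact: hC|exact: hD|exact: hA
  |exact: hV|].
apply: hR; elim: E => [|[y t] E IHE] /=; first exact: I.
by split; [exact: IH|].
Qed.

Lemma dom_map (Act : Type) (f : var * term Act -> term Act) (E : spec Act) :
  dom [seq (e.1, f e) | e <- E] = dom E.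
Proof. by rewrite /dom -map_comp. Qed.

Lemma unguarded_free (Act : Type) y (t : term Act) :
  unguarded_in y t -> free_in y t.
Proof.
elim/term_nested_ind: t => //=.
- by move=> u v IHu IHv /orP[/IHu|/IHv] ->; rewrite ?orbT.
- by move=> u v IHu IHv /orP[/IHu|/IHv] ->; rewrite ?orbT.
- by move=> _ u v IHu IHv /orP[/IHu|/IHv] ->; rewrite ?orbT.
- move=> x E IHE /andP[-> /=].
  by elim: E IHE => //= e E IH [IHe /IH {}IH] /orP[/IHe|/IH] ->; rewrite ?orbT.
Qed.

Definition psubst (Act : Type) (s : var -> option (term Act)) : Prop :=
  forall y u, s y = Some u -> process u.

Lemma psubst_mask (Act : Type) V (s : var -> option (term Act)) :
  psubst s -> psubst (mask V s).
Proof. by move=> ps y u; rewrite /mask; case: ifP => // _ /ps. Qed.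

Lemma free_in_subst (Act : Type) y (s : var -> option (term Act)) t :
  psubst s -> free_in y (subst s t) -> free_in y t /\ s y = None.
Proof.
elim/term_nested_ind: t s => //=.
- by move=> u v IHu IHv s ps /orP[/(IHu _ ps)|/(IHv _ ps)] [-> ->];
    rewrite ?orbT.
- by move=> u v IHu IHv s ps /orP[/(IHu _ ps)|/(IHv _ ps)] [-> ->];
    rewrite ?orbT.
- by move=> u v IHu IHv s ps /orP[/(IHu _ ps)|/(IHv _ ps)] [-> ->];
    rewrite ?orbT.
- by move=> A u v IHu IHv s ps /orP[/(IHu _ ps)|/(IHv _ ps)] [-> ->];
    rewrite ?orbT.
- move=> x s ps; case sx: (s x) => [u|] /=.
    by case: (ps _ _ sx) => _ /(_ y) /negbTE ->.
  by move=> /eqP ->; rewrite eqxx.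
- move=> x E IHE s /(@psubst_mask _ (dom E)) ps; rewrite dom_map.
  case/andP=> yE; rewrite yE /=.
  have ->: s y = mask (dom E) s y by rewrite /mask (negbTE yE).
  move: (mask _ s) ps => {}s ps.
  elim: E IHE {yE} => //= e E IH [IHe /IH {}IH].
  by case/orP=> [/(IHe _ ps)|/IH] [-> ->]; rewrite ?orbT.
Qed.

Lemma unguarded_in_subst (Act : Type) y (s : var -> option (term Act)) t :
  psubst s -> unguarded_in y (subst s t) -> unguarded_in y t.
Proof.
elim/term_nested_ind: t s => //=.
- by move=> u v IHu IHv s ps /orP[/(IHu _ ps)|/(IHv _ ps)] ->;
    rewrite ?orbT.
- by move=> u v IHu IHv s ps /orP[/(IHu _ ps)|/(IHv _ ps)] ->;
    rewrite ?orbT.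
- by move=> A u v IHu IHv s ps /orP[/(IHu _ ps)|/(IHv _ ps)] ->;
    rewrite ?orbT.
- move=> x s ps; case sx: (s x) => [u|] //= /unguarded_free.
  by case: (ps _ _ sx) => _ /(_ y) /negbTE ->.
- move=> x E IHE s /(@psubst_mask _ (dom E)) ps; rewrite dom_map.
  case/andP=> -> /=; move: (mask _ s) ps => {}s ps.
  elim: E IHE => //= e E IH [IHe /IH {}IH].
  by case/orP=> [/(IHe _ ps)|/IH] ->; rewrite ?orbT.
Qed.

Lemma wf_subst (Act : Type) (s : var -> option (term Act)) t :
  psubst s -> wf t -> wf (subst s t).
Proof.
elim/term_nested_ind: t s => //=.
- by move=> u v IHu IHv s ps /andP[/(IHu _ ps) -> /(IHv _ ps) ->].
- by move=> u v IHu IHv s ps /andP[/(IHu _ ps) -> /(IHv _ ps) ->].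
- by move=> u v IHu IHv s ps /andP[/(IHu _ ps) -> /(IHv _ ps) ->].
- by move=> A u v IHu IHv s ps /andP[/(IHu _ ps) -> /(IHv _ ps) ->].
- by move=> x s ps _; case sx: (s x) => [u|] //=; case: (ps _ _ sx).
- move=> x E IHE s /(@psubst_mask _ (dom E)) ps; rewrite dom_map.
  case/and4P=> -> -> gE wE /=; move: (mask _ s) ps => {}s ps.
  move: (dom E) gE => V gE; apply/andP; split.
    rewrite all_map; apply: sub_all gE => e /= /allP ge; apply/allP => y yV.
    by apply: contra (ge y yV); apply: unguarded_in_subst.
  elim: E IHE wE {gE} => //= e E IH [IHe /IH {}IH] /andP[we /IH ->].
  by rewrite IHe.
Qed.

Lemma process_rec (Act : Type) (X Y : var) (E : spec Act) :
  process (Rec X E) -> Y \in dom E -> process (Rec Y E).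
Proof.
by case=> /= /and4P[uE _ gE wE] clE YE; split=> //=; rewrite uE YE gE wE.
Qed.

Lemma rhs_dom (Act : Type) (E : spec Act) Y t :
  rhs E Y = Some t -> Y \in dom E.
Proof.
elim: E => //= -[Z u] E IH /=.
by rewrite inE; case: eqP => //= _ /IH.
Qed.

Lemma process_unfold (Act : Type) X (E : spec Act) Y t :
  process (Rec X E) -> rhs E Y = Some t -> process (unfold E t).
Proof.
move=> pE Et.
have ps : psubst (fun y => if y \in dom E then Some (Rec y E) else None).
  by move=> y u; case: ifP => // yE [<-]; apply: process_rec pE yE.
case: pE => /= /and4P[_ _ _ wE] clE.
have [wt ft] : wf t /\ forall y, free_in y t -> has (fun e => free_in y e.2) E.
  elim: E Et wE {ps clE} => //= -[Z u] E IH /= + /andP[wu wE].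
  case: eqP => [_ [<-]|_ /IH /(_ wE) [wt ft]]; first by split=> // y ->.
  by split=> // y /ft ->; rewrite orbT.
split; first exact: wf_subst.
move=> y; apply/negP => /(free_in_subst ps) [/ft fy].
by move: (clE y); rewrite fy andbT negbK => ->.
Qed.

Lemma process2 (Act : Type) (op : term Act -> term Act -> term Act) u v :
  (forall u v, wf (op u v) = wf u && wf v) ->
  (forall y u v, free_in y (op u v) = free_in y u || free_in y v) ->
  process (op u v) <-> process u /\ process v.
Proof.
move=> wop fop; split=> [[]|[[wu fu] [wv fv]]].
  rewrite wop => /andP[wu wv] fuv.
  by split; split=> // y; move: (fuv y); rewrite fop negb_or => /andP[].
by split=> [|y]; rewrite ?wop ?wu // fop negb_or fu fv.
Qed.

Lemma step_process (Act : Type) (M : lts Act) p l q :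
  step_red M p l q -> process p -> process q.
Proof.
have pE := fun u v => @process2 Act (@Ext Act) u v.
have pC := fun u v => @process2 Act (@Conj Act) u v.
have pD := fun u v => @process2 Act (@Disj Act) u v.
have pP := fun A u v => @process2 Act (@Par Act A) u v.
elim=> {p l q} //.
- by move=> a x1 x2 y1 _ IH _ /pE [] // /IH.
- by move=> a x1 x2 y1 _ IH _ /pE [] // _ /IH.
- by move=> x1 x2 y1 _ IH /pE [] // /IH *; apply/pE.
- by move=> x1 x2 y1 _ IH /pE [] // ? /IH *; apply/pE.
- by move=> x1 x2 y1 _ IH /pC [] // /IH *; apply/pC.
- by move=> x1 x2 y1 _ IH /pC [] // ? /IH *; apply/pC.
- by move=> a x1 x2 y1 y2 _ IH1 _ IH2 /pC [] // /IH1 ? /IH2 *; apply/pC.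
- by move=> x1 x2 /pD [].
- by move=> x1 x2 /pD [].
- by move=> A x1 x2 y1 _ IH /pP [] // /IH *; apply/pP.
- by move=> A x1 x2 y1 _ IH /pP [] // ? /IH *; apply/pP.
- by move=> A a x1 x2 y1 _ _ IH _ /pP [] // /IH *; apply/pP.
- by move=> A a x1 x2 y1 _ _ IH _ /pP [] // ? /IH *; apply/pP.
- by move=> A a x1 x2 y1 y2 _ _ IH1 _ IH2 /pP [] // /IH1 ? /IH2 *; apply/pP.
- by move=> l Y E t y Et _ IH /process_unfold /(_ Et) /IH.
Qed.

Lemma subst1_process (Act : Type) X (p C : term Act) :
  process p -> context X C -> process (subst1 X p C).
Proof.
move=> pp [wC fC].
have ps : psubst (fun y => if y == X then Some p else None).
  by move=> y u; case: ifP => // _ [<-].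
split=> [|y]; first exact: wf_subst.
apply/negP => /(free_in_subst ps) [/fC ->].
by rewrite eqxx.
Qed.

(* Main.v *)
(** A process is inconsistent iff all its stable [tau]-derivatives are: the
    rules for conjunction and recursion say so, and the other operators inherit
    it.  In particular [F] is closed under [tau]-steps, so a [tau]-path that ends
    outside [F] lies outside [F] entirely, and [rs] only compares consistent
    stable [tau]-derivatives.

    Let [s] and [t] have the same context around holes related by [rs] ([ctx]).
    Evaluate [s] by [tau]-steps to a consistent stable [s'], operator by operator;
    guardedness makes this evaluation well-founded.  Following it in [t], and
    using the hypothesis at the holes, gives a stable [tau]-derivative [t'] of [t]
    with [act s' t'], where [act] relates stable terms of the same shape whose
    active holes are related by [rs_stable].  Finally [act] is a stable ready
    simulation: actions are compared by induction on [act], and inconsistency is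
    reflected by induction on the derivation that the right-hand term is
    inconsistent. *)

From mathcomp Require Import all_boot.
From Stdlib Require Import Relation_Operators Classical.
Require Import Defs.

Set Implicit Arguments.
Unset Strict Implicit.
Unset Printing Implicit Defensive.

(** * Substitution and guardedness *)

Section Terms.
Variable Act : Type.
Implicit Types (s t u v : term Act) (E : spec Act).

Lemma dom_rhs E Y : Y \in dom E -> exists u, rhs E Y = Some u.
Proof.
elim: E => //= -[Z u] E IH; rewrite inE /=.
by case: eqP => [_ _|_ /IH //]; exists u.
Qed.

Lemma rhs_map (f : term Act -> term Act) E Y :
  rhs [seq (e.1, f e.2) | e <- E] Y = omap f (rhs E Y).
Proof. by elim: E => //= -[Z u] E IH /=; case: eqP. Qed.

Lemma term_rhs_ind (P : term Act -> Prop) :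
  P Nil -> P Bot -> (forall l u, P u -> P (Pref l u)) ->
  (forall u v, P u -> P v -> P (Ext u v)) ->
  (forall u v, P u -> P v -> P (Conj u v)) ->
  (forall u v, P u -> P v -> P (Disj u v)) ->
  (forall A u v, P u -> P v -> P (Par A u v)) ->
  (forall x, P (Var x)) ->
  (forall x E, (forall Y u, rhs E Y = Some u -> P u) -> P (Rec x E)) ->
  forall t, P t.
Proof.
move=> hN hB hP hE hC hD hA hV hR.
apply: term_nested_ind => // x E IH; apply: hR => Y u.
by elim: E IH => //= -[Z v] E IH [Pv /IH {}IH]; case: eqP => // _ [<-].
Qed.

Lemma rhs_all (b : pred (term Act)) E Y u :
  all (fun e => b e.2) E -> rhs E Y = Some u -> b u.
Proof.
by elim: E => //= -[Z v] E IH /= /andP[bv /IH {}IH]; case: eqP => // _ [<-].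
Qed.

Lemma rhs_has (b : pred (term Act)) E Y u :
  rhs E Y = Some u -> b u -> has (fun e => b e.2) E.
Proof.
elim: E => //= -[Z v] E IH /=; case: eqP => [_ [->] -> //|_ /IH {}IH /IH ->].
by rewrite orbT.
Qed.

Lemma subst_fresh (s : var -> option (term Act)) t :
  (forall y, free_in y t -> s y = None) -> subst s t = t.
Proof.
elim/term_nested_ind: t s => //=.
- by move=> l u IH s H; rewrite IH.
- by move=> u v IHu IHv s H; rewrite IHu ?IHv // => y yt; apply: H;
    rewrite yt ?orbT.
- by move=> u v IHu IHv s H; rewrite IHu ?IHv // => y yt; apply: H;
    rewrite yt ?orbT.
- by move=> u v IHu IHv s H; rewrite IHu ?IHv // => y yt; apply: H;
    rewrite yt ?orbT.
- by move=> A u v IHu IHv s H; rewrite IHu ?IHv // => y yt; apply: H;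
    rewrite yt ?orbT.
- by move=> x s H; rewrite H.
- move=> x E IHE s H; congr Rec.
  have {}H y : has (fun e => free_in y e.2) E -> mask (dom E) s y = None.
    by rewrite /mask => Hy; case: ifP => // /negbT yE; rewrite H // yE.
  move: (mask _ s) H => {}s.
  elim: E IHE => //= -[Z u] E IH [IHu /IH {}IH] H /=.
  rewrite IHu ?IH // => y yt; apply: H; rewrite yt ?orbT //.
Qed.

Lemma subst_process (s : var -> option (term Act)) t :
  process t -> subst s t = t.
Proof. by case=> _ ct; apply: subst_fresh => y /(negP (ct y)). Qed.

(** The values of [s1] are closed, so [s2] leaves them unchanged. The composite [s] is constrained
    pointwise, so that the hypothesis passes under [mask] without functional extensionality. *)
Lemma subst_comp (s1 s2 s : var -> option (term Act)) t :
  psubst s1 -> (forall y, s y = if s1 y is Some v then Some v else s2 y) ->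
  subst s2 (subst s1 t) = subst s t.
Proof.
elim/term_nested_ind: t s1 s2 s => //=.
- by move=> l u IH s1 s2 s p1 sE; rewrite (IH _ _ s).
- by move=> u v IHu IHv s1 s2 s p1 sE; rewrite (IHu _ _ s) ?(IHv _ _ s).
- by move=> u v IHu IHv s1 s2 s p1 sE; rewrite (IHu _ _ s) ?(IHv _ _ s).
- by move=> u v IHu IHv s1 s2 s p1 sE; rewrite (IHu _ _ s) ?(IHv _ _ s).
- by move=> A u v IHu IHv s1 s2 s p1 sE; rewrite (IHu _ _ s) ?(IHv _ _ s).
- move=> x s1 s2 s p1 sE; rewrite sE; case s1x: (s1 x) => [v|] //=.
  exact: subst_process (p1 _ _ s1x).
- move=> x E IHE s1 s2 s p1 sE; congr Rec.
  rewrite -map_comp dom_map /=.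
  have {}sE y : mask (dom E) s y =
      if mask (dom E) s1 y is Some v then Some v else mask (dom E) s2 y.
    by rewrite /mask; case: ifP.
  move/(@psubst_mask _ (dom E)): p1 => p1.
  move: (mask _ s) (mask _ s1) (mask _ s2) sE p1 => {}s {}s1 {}s2 sE p1.
  by elim: E IHE => //= e E IH [IHe /IH ->]; rewrite (IHe s1 s2 s).
Qed.

(** Unfolding the specifications met outside prefixes and disjunctions
    terminates: this is the only use made of guardedness. *)
Inductive unfolds : term Act -> Prop :=
| unfolds_nil : unfolds Nil
| unfolds_bot : unfolds Bot
| unfolds_pref l u : unfolds (Pref l u)
| unfolds_disj u v : unfolds (Disj u v)
| unfolds_ext u v : unfolds u -> unfolds v -> unfolds (Ext u v)
| unfolds_conj u v : unfolds u -> unfolds v -> unfolds (Conj u v)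
| unfolds_par A u v : unfolds u -> unfolds v -> unfolds (Par A u v)
| unfolds_rec Y E u : rhs E Y = Some u -> unfolds (unfold E u) ->
    unfolds (Rec Y E).

(** The induction is on the open term, since unfolding can make the closed one grow. At a recursion
    the substitution gains the bound variables, and guardedness makes the last hypothesis vacuous
    for them. *)
Lemma unfolds_subst (s : var -> option (term Act)) t :
  psubst s -> wf t -> (forall y, free_in y t -> s y) ->
  (forall y v, unguarded_in y t -> s y = Some v -> unfolds v) ->
  unfolds (subst s t).
Proof.
elim/term_rhs_ind: t s => //=; try by move=> *; constructor.
- move=> u v IHu IHv s ps /andP[wu wv] cs us.
  by constructor; [apply: IHu|apply: IHv] => // y;
    [move=> yu; apply: cs|move=> w yu; apply: us|move=> yu; apply: cs
    |move=> w yu; apply: us]; rewrite yu ?orbT.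
- move=> u v IHu IHv s ps /andP[wu wv] cs us.
  by constructor; [apply: IHu|apply: IHv] => // y;
    [move=> yu; apply: cs|move=> w yu; apply: us|move=> yu; apply: cs
    |move=> w yu; apply: us]; rewrite yu ?orbT.
- move=> A u v IHu IHv s ps /andP[wu wv] cs us.
  by constructor; [apply: IHu|apply: IHv] => // y;
    [move=> yu; apply: cs|move=> w yu; apply: us|move=> yu; apply: cs
    |move=> w yu; apply: us]; rewrite yu ?orbT.
- move=> x s ps _ cs us; case sx: (s x) (cs x (eqxx x)) => [v|] // _.
  exact: us (eqxx x) sx.
- move=> x E IHE s ps wE cs us.
  pose E1 := [seq (e.1, subst (mask (dom E) s) e.2) | e <- E].
  have pE1 : process (Rec x E1).
    split; first exact: (@wf_subst _ s (Rec x E)).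
    move=> y; apply/negP => /(@free_in_subst _ y s (Rec x E) ps) [/cs].
    by move=> + sy; rewrite sy.
  have dE1 : dom E1 = dom E by apply: dom_map.
  move: wE => /and4P[_ xE gE wE].
  have [u Eu] := dom_rhs xE.
  apply: (@unfolds_rec _ _ (subst (mask (dom E) s) u)).
    by rewrite -/E1 rhs_map Eu.
  (* Substituting by [s] and then unfolding amounts to the single substitution [s1] in the original
     right-hand side [u], where the induction hypothesis applies. *)
  pose s1 y := if y \in dom E then Some (Rec y E1) else s y.
  rewrite -/E1 /unfold (@subst_comp _ _ s1); first last.
  - move=> y; rewrite /s1 /mask dE1; case: ifP => // _.
    by case: (s y).
  - exact: psubst_mask.
  apply: (IHE _ _ Eu).
  - move=> y v; rewrite /s1; case: ifP => [yE [<-]|_ /ps //].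
    by apply: process_rec pE1 _; rewrite dE1.
  - exact: rhs_all wE Eu.
  - move=> y yu; rewrite /s1; case: ifP => // /negbT yE.
    by apply: cs; rewrite yE; apply: rhs_has Eu yu.
  - move=> y v yu; rewrite /s1; case: ifP => [yE|/negbT yE].
      have := rhs_all (b := fun t => all (fun y => ~~ unguarded_in y t) (dom E))
        gE Eu.
      by move=> /allP /(_ y yE); rewrite yu.
    by apply: us; rewrite yE; apply: rhs_has Eu yu.
Qed.

Lemma unfolds_process t : process t -> unfolds t.
Proof.
(* The empty substitution turns a closed term into an instance of [unfolds_subst]. *)
move=> [wt ct]; rewrite -(@subst_fresh (fun _ => None) t) //.
by apply: unfolds_subst => // y /(negP (ct y)).
Qed.

(** These operators share the [tau]-rules, where one argument moves and the operator stays, and the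
    propagation of [F] from either argument. Through [app2] one proof serves all three. *)
Variant static_op := OpExt | OpConj | OpPar of (Act -> Prop).

Definition app2 o u v :=
  match o with
  | OpExt => Ext u v
  | OpConj => Conj u v
  | OpPar A => Par A u v
  end.

Lemma process_app2 o u v : process (app2 o u v) <-> process u /\ process v.
Proof. by case: o => [||A]; apply: process2. Qed.

Lemma subst_app2 (s : var -> option (term Act)) o u v :
  subst s (app2 o u v) = app2 o (subst s u) (subst s v).
Proof. by case: o. Qed.

Lemma app2_inj o o' u v u' v' : app2 o u v = app2 o' u' v' ->
  [/\ o = o', u = u' & v = v'].
Proof. by case: o o' => [||A] [||A'] //= -[] => [|| ->] -> ->. Qed.

End Terms.

(** * Transitions and inconsistency *)

Section Model.
Variables (Act : Type) (tr : lts Act) (F : term Act -> Prop).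
Hypothesis Hmodel : stable_model tr F.
Implicit Types (s t u v w p q : term Act) (E : spec Act) (o : static_op Act).

Local Notation stable := (stable tr).
Local Notation can := (can tr).
Local Notation eps_stable := (eps_stable tr).

Lemma trE p l q : tr p l q <-> step_red tr p l q.
Proof. by case: Hmodel. Qed.

Lemma FE p : F p <-> F_red tr p.
Proof. by case: Hmodel. Qed.

Lemma tr_process p l q : tr p l q -> process p -> process q.
Proof. by move/trE; apply: step_process. Qed.

Lemma tr_rec Y E u l z : rhs E Y = Some u ->
  tr (Rec Y E) l z <-> tr (unfold E u) l z.
Proof.
move=> Eu; rewrite !trE; split=> [H|]; last exact: step_rec.
by inversion H; subst; move: Eu; rewrite H2 => -[<-].
Qed.

Lemma can_rec Y E u l : rhs E Y = Some u ->
  can (Rec Y E) l <-> can (unfold E u) l.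
Proof. by move=> Eu; split=> -[z /(tr_rec _ _ Eu) H]; exists z. Qed.

Lemma stable_rec Y E u : rhs E Y = Some u ->
  stable (Rec Y E) <-> stable (unfold E u).
Proof. by move=> Eu; rewrite /Defs.stable (can_rec _ Eu). Qed.

Lemma tr_app2_tau o u v z : tr (app2 o u v) tau z <->
  (exists2 u', tr u tau u' & z = app2 o u' v) \/
  (exists2 v', tr v tau v' & z = app2 o u v').
Proof.
split=> [/trE H|[] [x /trE Hx ->]]; last 2 first.
- by apply/trE; case: o => *; constructor.
- by apply/trE; case: o => *; constructor.
by case: o H => [||A] H; inversion H; subst;
  [left|right|left|right|left|right]; exists y1 => //; apply/trE.
Qed.

Lemma stable_app2 o u v : stable (app2 o u v) <-> stable u /\ stable v.
Proof.
split=> [H|[su sv] [z /tr_app2_tau [] [x Hx _]]].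
- split=> -[x Hx]; apply: H.
    by exists (app2 o x v); apply/tr_app2_tau; left; exists x.
  by exists (app2 o u x); apply/tr_app2_tau; right; exists x.
- by apply: su; exists x.
- by apply: sv; exists x.
Qed.

Lemma stable_leaf p : (forall z, ~ step_red tr p tau z) -> stable p.
Proof. by move=> H [z /trE /H]. Qed.

Lemma stable_nil : stable Nil.
Proof. by apply: stable_leaf => z H; inversion H. Qed.

Lemma stable_bot : stable Bot.
Proof. by apply: stable_leaf => z H; inversion H. Qed.

Lemma stable_pref a u : stable (Pref (vis a) u).
Proof. by apply: stable_leaf => z H; inversion H. Qed.

(** In external choice and interleaving, the stability of the idle argument is a negative premise.
    In the synchronous rules both arguments move visibly, and induction gives their stability. *)
Lemma tr_vis_stable p a q : tr p (vis a) q -> stable p.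
Proof.
move/trE; move El: (vis a) => l H.
elim: H a El => {p l q} //.
- by move=> l x a <-; apply: stable_pref.
- move=> a x1 x2 y1 _ IH s2 _ _.
  by apply/(stable_app2 (OpExt Act)); split; [apply: IH erefl|].
- move=> a x1 x2 y1 _ IH s2 _ _.
  by apply/(stable_app2 (OpExt Act)); split; [|apply: IH erefl].
- move=> a x1 x2 y1 y2 _ IH1 _ IH2 _ _.
  by apply/(stable_app2 (OpConj Act)); split; [apply: IH1 erefl|apply: IH2 erefl].
- move=> A a x1 x2 y1 _ _ IH s2 _ _.
  by apply/(stable_app2 (OpPar A)); split; [apply: IH erefl|].
- move=> A a x1 x2 y1 _ _ IH s2 _ _.
  by apply/(stable_app2 (OpPar A)); split; [|apply: IH erefl].
- move=> A a x1 x2 y1 y2 _ _ IH1 _ IH2 _ _.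
  by apply/(stable_app2 (OpPar A)); split; [apply: IH1 erefl|apply: IH2 erefl].
- by move=> l Y E t y Et _ IH a El; apply/(stable_rec Et); apply: IH El.
Qed.

(** * Stable [tau]-derivatives *)

Lemma eps_refl p : stable p -> eps_stable p p.
Proof. by move=> sp; split=> //; apply: rt1n_refl. Qed.

Lemma eps_step p q r : tr p tau q -> eps_stable q r -> eps_stable p r.
Proof. by move=> pq [qr sr]; split=> //; apply: rt1n_trans pq qr. Qed.

Lemma eps_stable_end p q : eps_stable p q -> stable q.
Proof. by case. Qed.

Lemma eps_stable_ind (P : term Act -> term Act -> Prop) :
  (forall p, stable p -> P p p) ->
  (forall p q r, tr p tau q -> eps_stable q r -> P q r -> P p r) ->
  forall p r, eps_stable p r -> P p r.
Proof.
move=> Hr Hs p r [pr]; elim: pr => [{}p|{}p q {}r pq qr IH] sr.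
  exact: Hr.
by apply: Hs pq _ (IH sr); split.
Qed.

Lemma eps_inv p r : eps_stable p r ->
  (p = r /\ stable p) \/ exists2 q, tr p tau q & eps_stable q r.
Proof.
move: p r; apply: eps_stable_ind => [p sp|p q r pq qr _]; first by left.
by right; exists q.
Qed.

Lemma eps_of_stable p r : stable p -> eps_stable p r -> r = p.
Proof. by move=> sp /eps_inv [[->]|[q pq _]] //; case: sp; exists q. Qed.

Lemma eps_process p r : eps_stable p r -> process p -> process r.
Proof.
move: p r; apply: eps_stable_ind => [p //|p q r pq _ IH pp].
by apply: IH; apply: tr_process pq pp.
Qed.

Lemma eps_app2 o u v u' v' : eps_stable u u' -> eps_stable v v' ->
  eps_stable (app2 o u v) (app2 o u' v').
Proof.
move=> uu'; move: u u' uu'; apply: eps_stable_ind => [u su|u x u' ux _ IH] vv'.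
  move: v v' vv'; apply: eps_stable_ind => [v sv|v x v' vx _ IH].
    by apply: eps_refl; apply/stable_app2.
  by apply: eps_step IH; apply/tr_app2_tau; right; exists x.
by apply: eps_step (IH vv'); apply/tr_app2_tau; left; exists x.
Qed.

Lemma eps_app2_inv o u v z : eps_stable (app2 o u v) z ->
  exists u' v', [/\ z = app2 o u' v', eps_stable u u' & eps_stable v v'].
Proof.
move Ep: (app2 o u v) => p pz; move: p z pz u v Ep.
apply: eps_stable_ind => [p sp|p q r pq _ IH] u v Ep; subst.
  case/stable_app2: sp => su sv.
  by exists u, v; split=> //; apply: eps_refl.
case/tr_app2_tau: pq => -[x Hx qE];
  have [u' [v' [-> uu' vv']]] := IH _ _ (esym qE); exists u', v'; split=> //.
  exact: eps_step Hx uu'.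
exact: eps_step Hx vv'.
Qed.

(** A recursion and its unfolding have the same transitions, but their trivial paths end in
    different terms; instability of the unfolding excludes these paths. *)
Lemma eps_rec Y E u z : rhs E Y = Some u -> ~ stable (unfold E u) ->
  eps_stable (Rec Y E) z <-> eps_stable (unfold E u) z.
Proof.
move=> Eu nst; split=> /eps_inv [[zE sz]|[q pq qz]] //.
- by move/(stable_rec Eu): sz.
- by apply: eps_step qz; apply/(tr_rec _ _ Eu).
- by apply: eps_step qz; apply/(tr_rec _ _ Eu).
Qed.

(** * Inconsistency and stable derivatives *)

Lemma F_app2_l o u v : F u -> F (app2 o u v).
Proof. by move/FE=> Fu; apply/FE; case: o => *; constructor. Qed.

Lemma F_app2_r o u v : F v -> F (app2 o u v).
Proof.
move/FE=> Fv; apply/FE; case: o => [||A] /=.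
- exact: F_ext_r.
- exact: F_conj_r.
- exact: F_par_r.
Qed.

Lemma F_unfold Y E u : rhs E Y = Some u -> F (unfold E u) -> F (Rec Y E).
Proof. by move=> Eu /FE Fu; apply/FE; apply: F_rec Eu Fu. Qed.

(** For conjunction and recursion this is a rule of [F], so a structural induction suffices and no
    specification is unfolded. Terms without stable derivatives satisfy the hypothesis vacuously:
    divergence counts as inconsistency. *)
Lemma F_eps p : (forall y, eps_stable p y -> F y) -> F p.
Proof.
have leaf u : (forall z, ~ step_red tr u tau z) ->
    (forall y, eps_stable u y -> F y) -> F u.
  by move=> H; apply; apply: eps_refl; apply: stable_leaf.
have static o u v : (o <> OpConj Act) ->
    ((forall y, eps_stable u y -> F y) -> F u) ->
    ((forall y, eps_stable v y -> F y) -> F v) ->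
    (forall y, eps_stable (app2 o u v) y -> F y) -> F (app2 o u v).
  move=> no IHu IHv H.
  (* Fix a consistent stable derivative [u'] of [u], if there is one. Every stable derivative [v']
     of [v] then gives an inconsistent [app2 o u' v'], and outside conjunction inversion can only
     blame [v']. *)
  have [[u' uu' nFu']|Hu] := classic (exists2 u', eps_stable u u' & ~ F u');
    last first.
    apply: F_app2_l; apply: IHu => u' uu'.
    by apply: NNPP => nF; apply: Hu; exists u'.
  apply: F_app2_r; apply: IHv => v' vv'.
  have /FE H' := H _ (eps_app2 o uu' vv').
  by case: o no {H} H' => [||A] // _ H'; inversion H'; subst;
    apply/FE => //; case: nFu'; apply/FE.
elim/term_nested_ind: p => [||l u IH|u v IHu IHv|u v _ _|u v IHu IHv
  |A u v IHu IHv|x|Y E _].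
- by apply: leaf => z H; inversion H.
- by apply: leaf => z H; inversion H.
- case: l => [|a] H; last by apply: leaf H => z H; inversion H.
  apply/FE; apply: F_pref; apply/FE; apply: IH => y uy; apply: H.
  by apply: eps_step uy; apply/trE; constructor.
- exact: (static (OpExt Act)).
- by move=> H; apply/FE; apply: F_conj_eps => y /H /FE.
- move=> H; apply/FE; apply: F_disj; apply/FE; [apply: IHu|apply: IHv] => y uy;
    by apply: H; apply: eps_step uy; apply/trE; constructor.
- exact: (static (OpPar A)).
- by apply: leaf => z H; inversion H.
- by move=> H; apply/FE; apply: F_rec_eps => y /H /FE.
Qed.

(** [F] on stable terms.  By [F_incons], [incons_F] and [F_eps], a term is in
    [F] iff all its stable [tau]-derivatives are in [incons], so inductions on
    [F] need neither the rules for divergence nor those for unstable terms. *)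
Inductive incons : term Act -> Prop :=
| incons_bot : incons Bot
| incons_pref a u : (forall y, eps_stable u y -> incons y) ->
    incons (Pref (vis a) u)
| incons_app2_l o u v : incons u -> incons (app2 o u v)
| incons_app2_r o u v : incons v -> incons (app2 o u v)
| incons_mismatch_l a u v :
    can u (vis a) -> ~ can v (vis a) -> incons (Conj u v)
| incons_mismatch_r a u v :
    can v (vis a) -> ~ can u (vis a) -> incons (Conj u v)
| incons_step a u v : can (Conj u v) (vis a) ->
    (forall w w', tr (Conj u v) (vis a) w -> eps_stable w w' -> incons w') ->
    incons (Conj u v)
| incons_rec Y E u : rhs E Y = Some u -> incons (unfold E u) ->
    incons (Rec Y E).

(** The induction on the derivation of [F] quantifies over all stable derivatives. This absorbs the
    two rules about them: a stable [y] is its own stable derivative, so the induction hypothesis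
    applies to [y] itself. *)
Lemma F_incons p y : F p -> eps_stable p y -> incons y.
Proof.
move/FE=> Fp; elim: Fp y => {p}.
- by move=> y /(eps_of_stable stable_bot) ->; constructor.
- move=> [|a] u _ IH y; last first.
    by move=> /(eps_of_stable (@stable_pref _ _)) ->; constructor.
  case/eps_inv => [[_ st]|[q /trE Hq]]; last by inversion Hq; subst; apply: IH.
  by case: st; exists u; apply/trE; constructor.
- move=> u v _ IHu _ IHv y /eps_inv [[_ st]|[q /trE Hq]].
    by case: st; exists u; apply/trE; constructor.
  by inversion Hq; subst; [apply: IHu|apply: IHv].
- move=> u v _ IH y /(@eps_app2_inv (OpExt Act)) [u' [v' [-> uu' vv']]].
  by apply: incons_app2_l; apply: IH.
- move=> u v _ IH y /(@eps_app2_inv (OpExt Act)) [u' [v' [-> uu' vv']]].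
  by apply: incons_app2_r; apply: IH.
- move=> A u v _ IH y /(@eps_app2_inv (OpPar A)) [u' [v' [-> uu' vv']]].
  by apply: incons_app2_l; apply: IH.
- move=> A u v _ IH y /(@eps_app2_inv (OpPar A)) [u' [v' [-> uu' vv']]].
  by apply: incons_app2_r; apply: IH.
- move=> u v _ IH y /(@eps_app2_inv (OpConj Act)) [u' [v' [-> uu' vv']]].
  by apply: (incons_app2_l (OpConj Act)); apply: IH.
- move=> u v _ IH y /(@eps_app2_inv (OpConj Act)) [u' [v' [-> uu' vv']]].
  by apply: (incons_app2_r (OpConj Act)); apply: IH.
- move=> a u v su [z /trE uz] nv y /(eps_of_stable su) ->.
  by apply: (@incons_mismatch_l a) => //; exists z.
- move=> a u v su [z /trE uz] nv y /(eps_of_stable su) ->.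
  by apply: (@incons_mismatch_r a) => //; exists z.
- move=> [|a] u v [z /trE uz] _ IH y.
    case/eps_inv => [[_ st]|[q uq qy]].
      by case: st; exists z.
    exact: IH uq _ qy.
  move=> /(eps_of_stable (tr_vis_stable uz)) ->.
  by apply: (@incons_step a) => [|w w' /IH]; [exists z|apply].
- by move=> u v _ IH y uy; apply: IH (uy) _ (eps_refl (eps_stable_end uy)).
- move=> Y E u Eu _ IH y.
  have [su|nsu] := classic (stable (unfold E u)).
    move: (su) => /(stable_rec Eu) sY /(eps_of_stable sY) ->.
    by apply: incons_rec Eu (IH _ (eps_refl su)).
  by move/(eps_rec _ Eu nsu)/IH.
- by move=> Y E _ IH y uy; apply: IH (uy) _ (eps_refl (eps_stable_end uy)).
Qed.

(** The mismatch rules of [F] demand a stable conjunction, whence the second hypothesis. Where a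
    premise of [incons] speaks of stable derivatives, [F_eps] carries [F] back to the term they come
    from. *)
Lemma incons_F p : incons p -> stable p -> F p.
Proof.
elim=> {p}.
- by move=> _; apply/FE; constructor.
- move=> a u _ IH _; apply/FE; constructor; apply/FE; apply: F_eps => y uy.
  exact: IH (eps_stable_end uy).
- by move=> o u v _ IH /stable_app2 [/IH Fu _]; apply: F_app2_l.
- by move=> o u v _ IH /stable_app2 [_ /IH Fu]; apply: F_app2_r.
- move=> a u v [z /trE uz] nv s; apply/FE.
  by apply: F_conj_mismatch_l nv => //; exists z.
- move=> a u v [z /trE uz] nv s; apply/FE.
  by apply: F_conj_mismatch_r nv => //; exists z.
- move=> a u v [z /trE uz] _ IH s; apply/FE; apply: (@F_conj_step _ _ (vis a)).
    by exists z.
  move=> w uw; apply/FE; apply: F_eps => w' ww'.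
  exact: IH uw ww' (eps_stable_end ww').
- by move=> Y E u Eu _ IH /(stable_rec Eu) /IH; apply: F_unfold.
Qed.

Lemma F_tau p q : F p -> tr p tau q -> F q.
Proof.
move=> Fp pq; apply: F_eps => y qy; apply: incons_F (eps_stable_end qy).
exact: F_incons Fp (eps_step pq qy).
Qed.

Lemma consistent_eps p : ~ F p -> exists2 y, eps_stable p y & ~ F y.
Proof.
move=> nF; apply: NNPP => H; apply: nF; apply: F_eps => y py.
by apply: NNPP => nFy; apply: H; exists y.
Qed.

Lemma eps_stable_F p q : eps_stable p q -> ~ F q -> ~ F p.
Proof.
move: p q; apply: eps_stable_ind => // p q r pq _ IH /IH nFq Fp.
by apply: nFq; apply: F_tau pq.
Qed.

(** * Ready simulation in terms of consistent end states *)

Lemma eps_F_stableE p q :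
  eps_F_stable tr F p q <-> eps_stable p q /\ ~ F q.
Proof.
split=> [[[nFp pq] sq]|[pq nFq]].
  by elim: pq nFp sq => [x|x y z [xy nFy] _ IH] nFx sz;
    [split=> //; apply: eps_refl
    |have [yz nFz] := IH nFy sz; split=> //; apply: eps_step yz].
split; last exact: eps_stable_end pq.
split; first exact: eps_stable_F pq nFq.
move: p q pq nFq; apply: eps_stable_ind => [p _ _|p q r pq qr IH nFr].
  exact: rt1n_refl.
by apply: rt1n_trans (IH nFr); split=> //; apply: eps_stable_F qr nFr.
Qed.

Lemma weak_F_stableE p a q : stable p ->
  weak_F_stable tr F p a q <->
  ~ F p /\ exists2 z, tr p (vis a) z & eps_stable z q /\ ~ F q.
Proof.
move=> sp; split=> [[[p1 [p2 [pp1 p12 p2q]]] sq]|[nFp [z pz /eps_F_stableE [zq sq]]]].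
  have [nFp _] := pp1; split=> //; exists p2; last by apply/eps_F_stableE.
  (* The source [p1] of a visible step is stable, so the path to it from the stable [p] is
     trivial. *)
  have [|pp1' _] := (proj1 (eps_F_stableE p p1)).
    by split=> //; apply: tr_vis_stable p12.
  by move: p12; rewrite (eps_of_stable sp pp1').
split=> //; exists p, z; split=> //.
by split=> //; apply: rt1n_refl.
Qed.

Lemma rsE p q : rs tr F p q <->
  forall p', eps_stable p p' -> ~ F p' ->
  exists q', [/\ eps_stable q q', ~ F q' & rs_stable tr F p' q'].
Proof.
split=> H p'.
  move=> pp' nF; have [|q' [/eps_F_stableE [qq' nFq] r]] := H p'.
    by apply/eps_F_stableE.
  by exists q'.
case/eps_F_stableE => pp' nF; have [q' [qq' nFq r]] := H _ pp' nF.
by exists q'; split=> //; apply/eps_F_stableE.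
Qed.

Lemma rs_stable_stable p q : rs_stable tr F p q -> stable p /\ stable q.
Proof. by case=> R [[_ HR] /HR []]. Qed.

Lemma rs_stable_F p q : rs_stable tr F p q -> F q -> F p.
Proof.
by case=> R [[_ HR] /HR [_ H _ _]] Fq; apply: NNPP => /H.
Qed.

Lemma rs_stable_can p q l : rs_stable tr F p q -> ~ F p -> can p l <-> can q l.
Proof. by case=> R [[_ HR] /HR [_ _ _ H]] /H. Qed.

Lemma rs_stable_vis p q a z z' : rs_stable tr F p q -> ~ F p ->
  tr p (vis a) z -> eps_stable z z' -> ~ F z' ->
  exists w w', [/\ tr q (vis a) w, eps_stable w w' & rs_stable tr F z' w'].
Proof.
case=> R [[HR1 HR] Rpq] nFp pz zz' nFz'; have [[sp sq] _ H _] := HR _ _ Rpq.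
have [|q' [/(weak_F_stableE _ _ sq) [_ [w qw [ww' _]]] Rzq]] := H a z'.
  by apply/weak_F_stableE => //; split=> //; exists z.
by exists w, q'; split=> //; exists R.
Qed.

(** Evaluation to a stable term that follows the syntax instead of a sequence of steps. Recursion
    has two rules because a stable [Rec Y E] stays folded; its rule still evaluates the unfolding to
    itself, so that inductions can descend into it. *)
Inductive eval : term Act -> term Act -> Prop :=
| eval_nil : eval Nil Nil
| eval_bot : eval Bot Bot
| eval_pref a u : eval (Pref (vis a) u) (Pref (vis a) u)
| eval_tau u y : eval u y -> eval (Pref tau u) y
| eval_disj_l u v y : eval u y -> eval (Disj u v) y
| eval_disj_r u v y : eval v y -> eval (Disj u v) y
| eval_app2 o u v u' v' : eval u u' -> eval v v' ->
    eval (app2 o u v) (app2 o u' v')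
| eval_rec Y E u y : rhs E Y = Some u -> ~ stable (unfold E u) ->
    eval (unfold E u) y -> eval (Rec Y E) y
| eval_rec_stable Y E u : rhs E Y = Some u -> stable (unfold E u) ->
    eval (unfold E u) (unfold E u) -> eval (Rec Y E) (Rec Y E).

Lemma eval_eps p q : eval p q -> eps_stable p q.
Proof.
elim=> {p q}.
- exact: eps_refl stable_nil.
- exact: eps_refl stable_bot.
- by move=> a u; apply: eps_refl; apply: stable_pref.
- by move=> u y _; apply: eps_step; apply/trE; constructor.
- by move=> u v y _; apply: eps_step; apply/trE; constructor.
- by move=> u v y _; apply: eps_step; apply/trE; constructor.
- by move=> o u v u' v' _ + _; apply: eps_app2.
- by move=> Y E u y Eu nsu _ /(eps_rec _ Eu nsu).
- by move=> Y E u Eu su _ _; apply: eps_refl; apply/(stable_rec Eu).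
Qed.

Lemma eval_refl p : unfolds p -> stable p -> eval p p.
Proof.
elim=> {p}.
- by move=> _; constructor.
- by move=> _; constructor.
- move=> [|a] u; last by constructor.
  by case; exists u; apply/trE; constructor.
- by move=> u v []; exists u; apply/trE; constructor.
- move=> u v _ IHu _ IHv /(stable_app2 (OpExt Act)) [/IHu Hu /IHv Hv].
  exact: (eval_app2 (OpExt Act)).
- move=> u v _ IHu _ IHv /(stable_app2 (OpConj Act)) [/IHu Hu /IHv Hv].
  exact: (eval_app2 (OpConj Act)).
- move=> A u v _ IHu _ IHv /(stable_app2 (OpPar A)) [/IHu Hu /IHv Hv].
  exact: (eval_app2 (OpPar A)).
- move=> Y E u Eu _ IH /(stable_rec Eu) su.
  exact: eval_rec_stable Eu su (IH su).
Qed.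

Lemma eval_app2_inv o u v z : eval (app2 o u v) z ->
  exists u' v', [/\ z = app2 o u' v', eval u u' & eval v v'].
Proof.
move Ep: (app2 o u v) => p H; case: H Ep; try by case: o.
move=> o' u1 v1 u' v' uu' vv' /app2_inj [-> -> ->].
by exists u', v'.
Qed.

(** Evaluation forgets how the [tau]-steps of two arguments interleave, so a step of one argument is
    prepended to the evaluation of that argument alone. *)
Lemma eval_step p q r : tr p tau q -> eval q r -> eval p r.
Proof.
move/trE; move El: tau => l H.
elim: H r El => {p l q} //.
- by move=> l x r <-; apply: eval_tau.
- move=> x1 x2 y1 _ IH r _ /(@eval_app2_inv (OpExt Act)) [u' [v' [-> Hu Hv]]].
  by apply: (eval_app2 (OpExt Act)) => //; apply: IH.
- move=> x1 x2 y1 _ IH r _ /(@eval_app2_inv (OpExt Act)) [u' [v' [-> Hu Hv]]].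
  by apply: (eval_app2 (OpExt Act)) => //; apply: IH.
- move=> x1 x2 y1 _ IH r _ /(@eval_app2_inv (OpConj Act)) [u' [v' [-> Hu Hv]]].
  by apply: (eval_app2 (OpConj Act)) => //; apply: IH.
- move=> x1 x2 y1 _ IH r _ /(@eval_app2_inv (OpConj Act)) [u' [v' [-> Hu Hv]]].
  by apply: (eval_app2 (OpConj Act)) => //; apply: IH.
- by move=> x1 x2 r _; apply: eval_disj_l.
- by move=> x1 x2 r _; apply: eval_disj_r.
- move=> A x1 x2 y1 _ IH r _ /(@eval_app2_inv (OpPar A)) [u' [v' [-> Hu Hv]]].
  by apply: (eval_app2 (OpPar A)) => //; apply: IH.
- move=> A x1 x2 y1 _ IH r _ /(@eval_app2_inv (OpPar A)) [u' [v' [-> Hu Hv]]].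
  by apply: (eval_app2 (OpPar A)) => //; apply: IH.
- move=> l Y E t y Et /trE Hy IH r El /(IH _ El) Hr.
  apply: eval_rec Et _ Hr => st; apply: st; exists y.
  by rewrite El.
Qed.

(** Guardedness enters at the end of the path: [unfolds_process] makes the evaluation of the final
    stable term to itself finite. The steps before it are then prepended one by one. *)
Lemma eps_eval p q : process p -> eps_stable p q -> eval p q.
Proof.
move=> pp pq; move: p q pq pp; apply: eps_stable_ind => [p sp|p q r pq _ IH] pp.
  exact: eval_refl (unfolds_process pp) sp.
by apply: eval_step (pq) _; apply: IH; apply: tr_process pq pp.
Qed.

(** * Contexts with related holes *)

(** Pairs [C{p/X}, C{q/X}], with any number of holes. *)
Inductive ctx : term Act -> term Act -> Prop :=
| ctx_hole p q : process p -> process q -> rs tr F p q -> ctx p q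
| ctx_nil : ctx Nil Nil
| ctx_bot : ctx Bot Bot
| ctx_var x : ctx (Var x) (Var x)
| ctx_pref l u u' : ctx u u' -> ctx (Pref l u) (Pref l u')
| ctx_disj u v u' v' : ctx u u' -> ctx v v' -> ctx (Disj u v) (Disj u' v')
| ctx_app2 o u v u' v' : ctx u u' -> ctx v v' ->
    ctx (app2 o u v) (app2 o u' v')
| ctx_rec Y E E' : dom E = dom E' ->
    (forall Z u u', rhs E Z = Some u -> rhs E' Z = Some u' -> ctx u u') ->
    ctx (Rec Y E) (Rec Y E').

Lemma ctx_refl t : ctx t t.
Proof.
elim/term_rhs_ind: t => [||l u IH|u v IHu IHv|u v IHu IHv|u v IHu IHv
  |A u v IHu IHv|x|Y E IH]; try by constructor.
- exact: (ctx_app2 (OpExt Act)).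
- exact: (ctx_app2 (OpConj Act)).
- exact: (ctx_app2 (OpPar A)).
- apply: ctx_rec => // Z u u' Eu; rewrite Eu => -[<-].
  exact: IH Eu.
Qed.

Definition ctx_opt (x y : option (term Act)) : Prop :=
  match x, y with
  | Some u, Some v => ctx u v
  | None, None => True
  | _, _ => False
  end.

(** Holes are closed, so substitution does not touch them; related specifications bind the same
    variables, so both substitutions are masked alike. *)
Lemma ctx_subst t t' (s s' : var -> option (term Act)) :
  ctx t t' -> (forall y, ctx_opt (s y) (s' y)) ->
  ctx (subst s t) (subst s' t').
Proof.
move=> H; elim: H s s' => {t t'} /=.
- move=> p q pp pq r s s' _; rewrite !subst_process //.
  exact: ctx_hole.
- by constructor.
- by constructor.
- move=> x s s' /(_ x); case: (s x) (s' x) => [u|] [u'|] //= _.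
  exact: ctx_var.
- by move=> l u u' _ IH s s' Hs; constructor; apply: IH.
- by move=> u v u' v' _ IHu _ IHv s s' Hs; constructor; [apply: IHu|apply: IHv].
- move=> o u v u' v' _ IHu _ IHv s s' Hs.
  by rewrite !subst_app2; apply: ctx_app2; [apply: IHu|apply: IHv].
- move=> Y E E' dE _ IH s s' Hs; apply: ctx_rec; first by rewrite !dom_map.
  move=> Z u u'; rewrite !rhs_map -dE.
  case Eu: (rhs E Z) => [v|] //= [<-]; case Eu': (rhs E' Z) => [v'|] //= [<-].
  apply: IH Eu Eu' _ _ _ => y; rewrite /mask.
  by case: ifP.
Qed.

Lemma ctx_unfold E E' Z u u' : dom E = dom E' ->
  (forall Z u u', rhs E Z = Some u -> rhs E' Z = Some u' -> ctx u u') ->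
  rhs E Z = Some u -> rhs E' Z = Some u' -> ctx (unfold E u) (unfold E' u').
Proof.
move=> dE H Eu Eu'; apply: ctx_subst; first exact: H Eu Eu'.
by move=> y; rewrite -dE; case: ifP => //= _; apply: ctx_rec.
Qed.

(** The instances of [ctx] between stable terms, closed under head unfolding:
    while [C{p/X}] stops at [<Y|E>], the term [C{q/X}] may have to unfold it
    for a [tau]-step of [q], and conversely. *)
Inductive act : term Act -> term Act -> Prop :=
| act_hole p q : rs_stable tr F p q -> act p q
| act_nil : act Nil Nil
| act_pref a u u' : ctx u u' -> act (Pref (vis a) u) (Pref (vis a) u')
| act_app2 o u v u' v' : act u u' -> act v v' ->
    act (app2 o u v) (app2 o u' v')
| act_rec_l Y E u t : rhs E Y = Some u -> act (unfold E u) t ->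
    act (Rec Y E) t
| act_rec_r Y E u s : rhs E Y = Some u -> act s (unfold E u) ->
    act s (Rec Y E).

Lemma act_stable s t : act s t -> stable s /\ stable t.
Proof.
elim=> {s t}.
- exact: rs_stable_stable.
- by split; apply: stable_nil.
- by move=> a u u' _; split; apply: stable_pref.
- by move=> o u v u' v' _ [? ?] _ [? ?]; split; apply/stable_app2.
- by move=> Y E u t Eu _ [? ?]; split=> //; apply/(stable_rec Eu).
- by move=> Y E u t Eu _ [? ?]; split=> //; apply/(stable_rec Eu).
Qed.

Lemma ctx_inv s t : ctx s t -> rs tr F s t \/
  match s with
  | Nil => t = Nil
  | Bot => t = Bot
  | Pref l u => exists2 u', t = Pref l u' & ctx u u'
  | Disj u v => exists u' v', [/\ t = Disj u' v', ctx u u' & ctx v v']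
  | Ext u v => exists u' v', [/\ t = Ext u' v', ctx u u' & ctx v v']
  | Conj u v => exists u' v', [/\ t = Conj u' v', ctx u u' & ctx v v']
  | Par A u v => exists u' v', [/\ t = Par A u' v', ctx u u' & ctx v v']
  | Var x => t = Var x
  | Rec Y E => exists E', [/\ t = Rec Y E', dom E = dom E' &
      forall Z u u', rhs E Z = Some u -> rhs E' Z = Some u' -> ctx u u']
  end.
Proof.
case=> {s t}; try by right.
- by left.
- by move=> l u u' uu'; right; exists u'.
- by move=> u v u' v' uu' vv'; right; exists u', v'.
- by move=> [||A] u v u' v' uu' vv'; right; exists u', v'.
- by move=> Y E E' dE HE; right; exists E'.
Qed.

Lemma ctx_app2_inv o u v t : ctx (app2 o u v) t -> rs tr F (app2 o u v) t \/
  exists u' v', [/\ t = app2 o u' v', ctx u u' & ctx v v'].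
Proof. by case: o => [||A] /ctx_inv. Qed.

(** At each node either the whole term is a hole, answered by [rs], or [t] has the same head and the
    induction goes on. Consistency of [s'] descends to its parts because [F] propagates upwards. *)
Lemma eval_ctx s s' t : eval s s' -> ctx s t -> ~ F s' ->
  exists2 t', eps_stable t t' & act s' t'.
Proof.
have hole p q p' : eval p p' -> ~ F p' -> rs tr F p q ->
    exists2 t', eps_stable q t' & act p' t'.
  move=> /eval_eps pp' nF /rsE /(_ _ pp' nF) [q' [qq' _ r]].
  by exists q' => //; apply: act_hole.
(* Whether the right-hand recursion stays folded depends on its own unfolding, whatever happens on
   the left; [act_rec_r] accounts for the folded case. *)
have unfold_r Y E u x : rhs E Y = Some u ->
    (exists2 t', eps_stable (unfold E u) t' & act x t') ->
    exists2 t', eps_stable (Rec Y E) t' & act x t'.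
  move=> Eu [t' ut' xt']; have [su|nsu] := classic (stable (unfold E u)).
    exists (Rec Y E); first by apply: eps_refl; apply/(stable_rec Eu).
    by apply: act_rec_r Eu _; rewrite -(eps_of_stable su ut').
  by exists t' => //; apply/(eps_rec _ Eu nsu).
move=> H; elim: H t => {s s'}.
- move=> t Ht nF; case: (ctx_inv Ht) => [/(hole _ _ _ eval_nil nF) //|->].
  by exists Nil; [apply: eps_refl stable_nil|constructor].
- by move=> t _ []; apply/FE; constructor.
- move=> a u t Ht nF.
  case: (ctx_inv Ht) => [/(hole _ _ _ (eval_pref a u) nF) //|[u' -> uu']].
  exists (Pref (vis a) u'); first exact: eps_refl (@stable_pref _ _).
  exact: act_pref.
- move=> u y uy IH t Ht nF.
  case: (ctx_inv Ht) => [/(hole _ _ _ (eval_tau uy) nF) //|[u' -> uu']].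
  have [t' ut' yt'] := IH _ uu' nF; exists t' => //.
  by apply: eps_step ut'; apply/trE; constructor.
- move=> u v y uy IH t Ht nF.
  case: (ctx_inv Ht) => [/(hole _ _ _ (eval_disj_l v uy) nF) //|].
  move=> [u' [v' [-> uu' _]]].
  have [t' ut' yt'] := IH _ uu' nF; exists t' => //.
  by apply: eps_step ut'; apply/trE; constructor.
- move=> u v y vy IH t Ht nF.
  case: (ctx_inv Ht) => [/(hole _ _ _ (eval_disj_r u vy) nF) //|].
  move=> [u' [v' [-> _ vv']]].
  have [t' ut' yt'] := IH _ vv' nF; exists t' => //.
  by apply: eps_step ut'; apply/trE; constructor.
- move=> o u v u1 v1 uu1 IHu vv1 IHv t Ht nF.
  case: (ctx_app2_inv Ht) => [/(hole _ _ _ (eval_app2 o uu1 vv1) nF) //|].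
  move=> [u' [v' [-> uu' vv']]].
  have [|u2 Hu au] := IHu _ uu'; first by move/(F_app2_l o v1).
  have [|v2 Hv av] := IHv _ vv'; first by move/(F_app2_r o u1).
  by exists (app2 o u2 v2); [apply: eps_app2|apply: act_app2].
- move=> Y E u y Eu nsu uy IH t Ht nF.
  case: (ctx_inv Ht) => [/(hole _ _ _ (eval_rec Eu nsu uy) nF) //|].
  move=> [E' [-> dE HE]].
  have [u' Eu'] : exists u', rhs E' Y = Some u'.
    by apply: dom_rhs; rewrite -dE; apply: rhs_dom Eu.
  by apply: unfold_r (Eu') _; apply: IH nF; apply: ctx_unfold Eu Eu'.
- move=> Y E u Eu su uu IH t Ht nF.
  case: (ctx_inv Ht) => [/(hole _ _ _ (eval_rec_stable Eu su uu) nF) //|].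
  move=> [E' [-> dE HE]].
  have [u' Eu'] : exists u', rhs E' Y = Some u'.
    by apply: dom_rhs; rewrite -dE; apply: rhs_dom Eu.
  (* The left-hand side stays folded: its stable unfolding is matched with the unfolding on the
     right, and [act_rec_l] folds it back. *)
  apply: unfold_r (Eu') _.
  have [||t' ut' at'] := IH (unfold E' u').
  - exact: ctx_unfold Eu Eu'.
  - by move/(F_unfold Eu).
  - by exists t' => //; apply: act_rec_l Eu at'.
Qed.

Lemma eps_ctx s s' t : process s -> eps_stable s s' -> ctx s t -> ~ F s' ->
  exists2 t', eps_stable t t' & act s' t'.
Proof. by move=> ps /(eps_eval ps); apply: eval_ctx. Qed.

(** * Visible actions of terms related by [act] *)

Definition vis_steps o a u v z : Prop :=
  match o with
  | OpExt => tr u (vis a) z \/ tr v (vis a) z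
  | OpConj => exists u' v', [/\ tr u (vis a) u', tr v (vis a) v' & z = Conj u' v']
  | OpPar A =>
      [\/ A a /\ exists u' v',
            [/\ tr u (vis a) u', tr v (vis a) v' & z = Par A u' v'],
          ~ A a /\ exists2 u', tr u (vis a) u' & z = Par A u' v
        | ~ A a /\ exists2 v', tr v (vis a) v' & z = Par A u v']
  end.

(** Stability of both arguments discharges every negative premise, which leaves only the visible
    steps of the arguments. *)
Lemma tr_app2_vis o a u v z : stable u -> stable v ->
  tr (app2 o u v) (vis a) z <-> vis_steps o a u v z.
Proof.
move=> su sv; split.
  move/trE; case: o => [||A] /= H; inversion H; subst.
  - by left; apply/trE.
  - by right; apply/trE.
  - by exists y1, y2; split=> //; apply/trE.
  - by apply: Or32; split=> //; exists y1 => //; apply/trE.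
  - by apply: Or33; split=> //; exists y1 => //; apply/trE.
  - by apply: Or31; split=> //; exists y1, y2; split=> //; apply/trE.
case: o => [||A] /=.
- by case=> /trE H; apply/trE; [apply: step_ext_l|apply: step_ext_r].
- by move=> [u' [v' [/trE Hu /trE Hv ->]]]; apply/trE; constructor.
- case=> -[HA].
  + by move=> [u' [v' [/trE Hu /trE Hv ->]]]; apply/trE; constructor.
  + by move=> [u' /trE Hu ->]; apply/trE; constructor.
  + by move=> [v' /trE Hv ->]; apply/trE; constructor.
Qed.

(** Readiness of a composite of stable terms is a propositional function of the readiness of its
    arguments, so equal ready sets pass through all three operators. *)
Definition vis_can o a (P Q : Prop) : Prop :=
  match o with
  | OpExt => P \/ Q
  | OpConj => P /\ Q
  | OpPar A => (A a /\ P /\ Q) \/ (~ A a /\ (P \/ Q))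
  end.

Lemma can_app2_vis o a u v : stable u -> stable v ->
  can (app2 o u v) (vis a) <-> vis_can o a (can u (vis a)) (can v (vis a)).
Proof.
move=> su sv; split.
  move=> [z /(tr_app2_vis _ _ _ su sv)]; case: o => [||A] /=.
  - by case=> H; [left|right]; exists z.
  - by move=> [u' [v' [Hu Hv _]]]; split; [exists u'|exists v'].
  - case=> -[HA].
    + by move=> [u' [v' [Hu Hv _]]]; left; split=> //; split;
        [exists u'|exists v'].
    + by move=> [u' Hu _]; right; split=> //; left; exists u'.
    + by move=> [v' Hv _]; right; split=> //; right; exists v'.
have tr_op z := proj2 (tr_app2_vis o a z su sv).
case: o tr_op => [||A] /= tr_op.
- by case=> -[z Hz]; exists z; apply: tr_op; [left|right].
- move=> [[u' Hu] [v' Hv]]; exists (Conj u' v'); apply: tr_op.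
  by exists u', v'.
- case=> -[HA] [].
  + move=> [u' Hu] [v' Hv]; exists (Par A u' v'); apply: tr_op.
    by apply: Or31; split=> //; exists u', v'.
  + move=> [u' Hu]; exists (Par A u' v); apply: tr_op.
    by apply: Or32; split=> //; exists u'.
  + move=> [v' Hv]; exists (Par A u v'); apply: tr_op.
    by apply: Or33; split=> //; exists v'.
Qed.

Lemma act_can s t a : act s t -> ~ F s -> can s (vis a) <-> can t (vis a).
Proof.
elim=> {s t}.
- by move=> p q; apply: rs_stable_can.
- by [].
- move=> b u u' _ _; split=> -[z /trE H]; inversion H; subst.
    by exists u'; apply/trE; constructor.
  by exists u; apply/trE; constructor.
- move=> o u v u' v' uu' IHu vv' IHv nF.
  have [su su'] := act_stable uu'; have [sv sv'] := act_stable vv'.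
  have {}IHu : can u (vis a) <-> can u' (vis a).
    by apply: IHu => /(F_app2_l o v).
  have {}IHv : can v (vis a) <-> can v' (vis a).
    by apply: IHv => /(F_app2_r o u).
  rewrite !can_app2_vis //; case: o {nF} => [||A] /=; tauto.
- move=> Y E u t Eu _ IH nF; rewrite (can_rec _ Eu); apply: IH.
  by move/(F_unfold Eu).
- by move=> Y E u s Eu _ IH nF; rewrite (can_rec _ Eu); apply: IH.
Qed.

(** A stable derivative of a composite splits into stable derivatives of the arguments, which are
    matched separately and recombined. Under a prefix the residuals are only related by [ctx], and
    [eps_ctx] leads back to [act]. *)
Lemma act_vis s t a z z' : act s t -> process s -> ~ F s ->
  tr s (vis a) z -> eps_stable z z' -> ~ F z' ->
  exists w w', [/\ tr t (vis a) w, eps_stable w w' & act z' w'].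
Proof.
move=> H; elim: H z z' => {s t}.
- move=> p q pq z z' _ nF pz zz' nFz'.
  have [w [w' [qw ww' r]]] := rs_stable_vis pq nF pz zz' nFz'.
  by exists w, w'; split=> //; apply: act_hole.
- by move=> z z' _ _ /trE H; inversion H.
- move=> b u u' uu' z z' [pu cu] nF /trE H; inversion H; subst => zz' nFz'.
  have pz : process z by split.
  have [w' u'w' aw'] := eps_ctx pz zz' uu' nFz'.
  by exists u', w'; split=> //; apply/trE; constructor.
- move=> o u v u' v' uu' IHu vv' IHv z z' /process_app2 [pu pv] nF.
  have [su su'] := act_stable uu'; have [sv sv'] := act_stable vv'.
  have nFu : ~ F u by move/(F_app2_l o v).
  have nFv : ~ F v by move/(F_app2_r o u).
  move=> /(tr_app2_vis _ _ _ su sv) Hz zz' nFz'.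
  have tr_op w := proj2 (tr_app2_vis o a w su' sv').
  have sync u1 v1 : z = app2 o u1 v1 -> tr u (vis a) u1 -> tr v (vis a) v1 ->
      exists w1 w2 w', [/\ tr u' (vis a) w1, tr v' (vis a) w2,
        eps_stable (app2 o w1 w2) w' & act z' w'].
    move=> zE uu1 vv1; move: zz' nFz'; rewrite zE.
    move=> /eps_app2_inv [u2 [v2 [-> uu2 vv2]]] nFz'.
    have [|w1 [w1' [H1 H1' a1]]] := IHu _ _ pu nFu uu1 uu2.
      by move/(F_app2_l o v2).
    have [|w2 [w2' [H2 H2' a2]]] := IHv _ _ pv nFv vv1 vv2.
      by move/(F_app2_r o u2).
    exists w1, w2, (app2 o w1' w2'); split=> //; first exact: eps_app2.
    exact: act_app2.
  (* The idle [v] is stable, so it is unchanged in the stable derivative and [vv'] still relates it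
     to [v']. *)
  have left_step u1 : z = app2 o u1 v -> tr u (vis a) u1 ->
      exists w1 w', [/\ tr u' (vis a) w1, eps_stable (app2 o w1 v') w' &
        act z' w'].
    move=> zE uu1; move: zz' nFz'; rewrite zE.
    move=> /eps_app2_inv [u2 [v2 [-> uu2 /(eps_of_stable sv) ->]]] nFz'.
    have [|w1 [w1' [H1 H1' a1]]] := IHu _ _ pu nFu uu1 uu2.
      by move/(F_app2_l o v).
    exists w1, (app2 o w1' v'); split=> //; last exact: act_app2.
    exact: eps_app2 H1' (eps_refl sv').
  have right_step v1 : z = app2 o u v1 -> tr v (vis a) v1 ->
      exists w2 w', [/\ tr v' (vis a) w2, eps_stable (app2 o u' w2) w' &
        act z' w'].
    move=> zE vv1; move: zz' nFz'; rewrite zE.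
    move=> /eps_app2_inv [u2 [v2 [-> /(eps_of_stable su) -> vv2]]] nFz'.
    have [|w2 [w2' [H2 H2' a2]]] := IHv _ _ pv nFv vv1 vv2.
      by move/(F_app2_r o u).
    exists w2, (app2 o u' w2'); split=> //; last exact: act_app2.
    exact: eps_app2 (eps_refl su') H2'.
  case: o nF Hz tr_op sync left_step right_step => [||A] /= nF.
  + case=> Hz tr_op _ _ _.
      have [w [w' [H1 H2 H3]]] := IHu _ _ pu nFu Hz zz' nFz'.
      by exists w, w'; split=> //; apply: tr_op; left.
    have [w [w' [H1 H2 H3]]] := IHv _ _ pv nFv Hz zz' nFz'.
    by exists w, w'; split=> //; apply: tr_op; right.
  + move=> [u1 [v1 [H1 H2 zE]]] tr_op sync _ _.
    have [w1 [w2 [w' [? ? ? ?]]]] := sync _ _ zE H1 H2.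
    by exists (Conj w1 w2), w'; split=> //; apply: tr_op; exists w1, w2.
  + case=> -[HA] => [[u1 [v1 [H1 H2 zE]]]|[u1 H1 zE]|[v1 H1 zE]] tr_op
      sync left_step right_step.
    * have [w1 [w2 [w' [? ? ? ?]]]] := sync _ _ zE H1 H2.
      exists (Par A w1 w2), w'; split=> //; apply: tr_op; apply: Or31.
      by split=> //; exists w1, w2.
    * have [w1 [w' [? ? ?]]] := left_step _ zE H1.
      exists (Par A w1 v'), w'; split=> //; apply: tr_op; apply: Or32.
      by split=> //; exists w1.
    * have [w1 [w' [? ? ?]]] := right_step _ zE H1.
      exists (Par A u' w1), w'; split=> //; apply: tr_op; apply: Or33.
      by split=> //; exists w1.
- move=> Y E u t Eu _ IH z z' pY nF /(tr_rec _ _ Eu) uz zz' nFz'.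
  apply: IH uz zz' nFz'; first exact: process_unfold pY Eu.
  by move/(F_unfold Eu).
- move=> Y E u s Eu _ IH z z' ps nF sz zz' nFz'.
  have [w [w' [H1 H2 H3]]] := IH _ _ ps nF sz zz' nFz'.
  by exists w, w'; split=> //; apply/(tr_rec _ _ Eu).
Qed.

(** * Reflection of inconsistency *)

Definition act_head s t : Prop :=
  rs_stable tr F s t \/
  match t with
  | Pref (vis a) u' => exists2 u, s = Pref (vis a) u & ctx u u'
  | Ext u' v' => exists u v, [/\ s = Ext u v, act u u' & act v v']
  | Conj u' v' => exists u v, [/\ s = Conj u v, act u u' & act v v']
  | Par A u' v' => exists u v, [/\ s = Par A u v, act u u' & act v v']
  | Rec Y E => exists2 u, rhs E Y = Some u & act s (unfold E u)
  | _ => t = Nil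
  end.

(** Layers of [act_rec_l] may hide the shape of [s]; they are stripped by unfolding down to [s0],
    whose inconsistency passes back to [s]. The default [t = Nil] in [act_head] is false for [Bot],
    variables, disjunctions and [tau]-prefixes, so only a hole can face these. *)
Lemma act_inv s t : act s t -> process s ->
  exists s0, [/\ process s0, act s0 t, F s0 -> F s & act_head s0 t].
Proof.
elim=> {s t}.
- move=> p q pq pp; exists p; split=> //; last by left.
  exact: act_hole.
- by exists Nil; split=> //; [constructor|right].
- move=> a u u' uu' pu; exists (Pref (vis a) u); split=> //.
    exact: act_pref.
  by right; exists u.
- move=> o u v u' v' uu' _ vv' _ p; exists (app2 o u v); split=> //.
    exact: act_app2.
  by right; case: (o) => [||A]; exists u, v.
- move=> Y E u t Eu _ IH pY; have [s0 [p0 a0 Fs0 h0]] := IH (process_unfold pY Eu).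
  by exists s0; split=> // /Fs0 /(F_unfold Eu).
- move=> Y E u s Eu su _ ps; exists s; split=> //.
    exact: act_rec_r Eu su.
  by right; exists u.
Qed.

Lemma act_app2_inv s o u' v' : act s (app2 o u' v') -> process s ->
  exists s0, [/\ process s0, act s0 (app2 o u' v'), F s0 -> F s &
    rs_stable tr F s0 (app2 o u' v') \/
    exists u v, [/\ s0 = app2 o u v, act u u' & act v v']].
Proof.
move=> H ps; have [s0 [? ? ? h0]] := act_inv H ps.
by exists s0; split=> //; move: h0; case: (o) => [||A].
Qed.

(** After passing to [s0], a hole is settled by [rs_stable]; otherwise the rule that makes [t]
    inconsistent is replayed on the left. *)
Lemma act_incons t s : incons t -> act s t -> process s -> F s.
Proof.
have hole p q : incons q -> rs_stable tr F p q -> F p.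
  move=> iq pq; apply: (rs_stable_F pq); apply: incons_F => //.
  by case: (rs_stable_stable pq).
move=> H; elim: (H) s => {t H}.
- move=> s a p; have [s0 [p0 a0 F0 h0]] := act_inv a p; apply: F0.
  case: h0 => [|//]; apply: hole.
  exact: incons_bot.
- move=> a u iu IH s sA p; have [s0 [p0 a0 F0 h0]] := act_inv sA p; apply: F0.
  case: h0 => [|[v s0E vu]]; first by apply: hole; apply: incons_pref.
  rewrite s0E; apply/FE; constructor; apply/FE.
  apply: NNPP => /consistent_eps [v' vv' nFv'].
  have pv : process v by move: p0; rewrite s0E => -[].
  have [u' uu' v'u'] := eps_ctx pv vv' vu nFv'.
  by apply: nFv'; apply: IH uu' _ v'u' _; apply: eps_process vv' pv.
- move=> o u v iu IH s sA p.
  have [s0 [p0 a0 F0 h0]] := act_app2_inv sA p; apply: F0.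
  case: h0 => [|[u0 [v0 [s0E uu vv]]]]; first by apply: hole; apply: incons_app2_l.
  move: p0; rewrite s0E => /process_app2 [pu _].
  by apply: F_app2_l; apply: IH.
- move=> o u v iv IH s sA p.
  have [s0 [p0 a0 F0 h0]] := act_app2_inv sA p; apply: F0.
  case: h0 => [|[u0 [v0 [s0E uu vv]]]]; first by apply: hole; apply: incons_app2_r.
  move: p0; rewrite s0E => /process_app2 [_ pv].
  by apply: F_app2_r; apply: IH.
- move=> a u v cu cv s sA p.
  have [s0 [p0 a0 F0 h0]] := @act_app2_inv _ (OpConj Act) _ _ sA p; apply: F0.
  case: h0 => [|[u0 [v0 [s0E uu vv]]]].
    by apply: hole; apply: incons_mismatch_l cu cv.
  (* Comparing ready sets by [act_can] takes consistent left-hand terms, hence the argument by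
     contradiction: consistency of [s0] gives that of its two arguments. *)
  apply: NNPP => nF; apply: (nF); rewrite s0E.
  have nFu : ~ F u0 by move/(F_app2_l (OpConj Act) v0); rewrite -s0E.
  have nFv : ~ F v0 by move/(F_app2_r (OpConj Act) u0); rewrite -s0E.
  apply: incons_F.
    by apply: (@incons_mismatch_l a); [apply/(act_can a uu nFu)|move/(act_can a vv nFv)].
  by rewrite -s0E; case: (act_stable a0).
- move=> a u v cv cu s sA p.
  have [s0 [p0 a0 F0 h0]] := @act_app2_inv _ (OpConj Act) _ _ sA p; apply: F0.
  case: h0 => [|[u0 [v0 [s0E uu vv]]]].
    by apply: hole; apply: incons_mismatch_r cv cu.
  apply: NNPP => nF; apply: (nF); rewrite s0E.
  have nFu : ~ F u0 by move/(F_app2_l (OpConj Act) v0); rewrite -s0E.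
  have nFv : ~ F v0 by move/(F_app2_r (OpConj Act) u0); rewrite -s0E.
  apply: incons_F.
    by apply: (@incons_mismatch_r a); [apply/(act_can a vv nFv)|move/(act_can a uu nFu)].
  by rewrite -s0E; case: (act_stable a0).
- move=> a u v cuv iw IH s sA p.
  have [s0 [p0 a0 F0 h0]] := @act_app2_inv _ (OpConj Act) _ _ sA p; apply: F0.
  case: h0 => [|[u0 [v0 [s0E _ _]]]].
    by apply: hole; apply: incons_step cuv iw.
  rewrite /= in s0E; apply: NNPP => nF; have [z s0z] := proj2 (act_can a a0 nF) cuv.
  apply: (nF); rewrite s0E; apply/FE; apply: (@F_conj_step _ _ (vis a)).
    by exists z; apply/trE; rewrite -s0E.
  (* A consistent [y] would have a consistent stable derivative [y']. By [act_vis] it is matched on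
     the right, and the induction hypothesis for the matching term makes [y'] inconsistent. *)
  rewrite -s0E => y s0y; apply/FE; apply: NNPP => /consistent_eps [y' yy' nFy'].
  have [w [w' [tw ww' y'w']]] := act_vis a0 p0 nF s0y yy' nFy'.
  apply: nFy'; apply: IH tw ww' _ y'w' _.
  exact: eps_process yy' (tr_process s0y p0).
- move=> Y E u Eu iu IH s sA p.
  have [s0 [p0 a0 F0 h0]] := act_inv sA p; apply: F0.
  case: h0 => [|[u' Eu' s0u]]; first by apply: hole; apply: incons_rec Eu iu.
  by move: Eu' s0u; rewrite Eu => -[<-] /IH; apply.
Qed.

Lemma act_rs_stable s t : process s -> process t -> act s t -> rs_stable tr F s t.
Proof.
move=> ps pt st; exists (fun s t => [/\ process s, process t & act s t]).
split=> //; split=> [{ps pt st}s {}t [] //|{ps pt st}s {}t [ps pt st]].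
have [ss st'] := act_stable st.
(* This is needed twice: for the pair [s], [t] itself and for the matched stable derivatives after a
   visible step. *)
have cons x y : process x -> act x y -> ~ F x -> ~ F y.
  move=> px xy nFx Fy; apply: nFx; apply: (act_incons _ xy px).
  by apply: F_incons Fy (eps_refl _); case: (act_stable xy).
split=> //; first exact: cons.
- move=> a p' /(weak_F_stableE _ _ ss) [nFs [z sz [zp' nFp']]].
  have [w [w' [tw ww' aw]]] := act_vis st ps nFs sz zp' nFp'.
  have pp' := eps_process zp' (tr_process sz ps).
  exists w'; split; last by split=> //; apply: eps_process ww' (tr_process tw pt).
  apply/(weak_F_stableE _ _ st'); split; first exact: cons st nFs.
  by exists w => //; split=> //; apply: cons aw nFp'.
- move=> nF [|a]; last exact: act_can.
  by split.
Qed.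

Lemma ctx_rs s t : process s -> process t -> ctx s t -> rs tr F s t.
Proof.
move=> ps pt st; apply/rsE => s' ss' nFs'.
have [t' tt' aa] := eps_ctx ps ss' st nFs'.
have r := act_rs_stable (eps_process ss' ps) (eps_process tt' pt) aa.
exists t'; split=> // Ft'; apply: nFs'; exact: rs_stable_F r Ft'.
Qed.

End Model.

Theorem mainTheorem1 (Act : Type) (tr : lts Act) (F : term Act -> Prop)
    (Hmodel : stable_model tr F)
    (p q : term Act) (Hp : process p) (Hq : process q)
    (X : var) (C : term Act) (HC : context X C) :
  rs tr F p q -> rs tr F (subst1 X p C) (subst1 X q C).
Proof.
move=> pq; apply: (ctx_rs Hmodel); try exact: subst1_process.
apply: ctx_subst; first exact: ctx_refl.
by move=> y; case: ifP => //= _; apply: ctx_hole.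
Qed.
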